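(* Let $\gamma,\eta\in(0,1)$ with $\gamma-\eta>0$, let $W\in\mathcal{C}^\gamma([0,T],H)$ and let $K\in\mathcal{K}_\eta$. Let $\Xi^\tau(t,s):=K(\tau,s)(W(t)-W(s))$. Then the pathwise Volterra process is defined as the integral $$X^\tau(t):=\int_0^tK(\tau,s)\,dW(s):=\mathcal{I}(\Xi^\tau)(t):=\lim_{|\mathcal{P}|\to0}\sum_{[u,v]\in\mathcal{P}}\Xi^\tau(v,u),\qquad(\tau,t)\in\Delta_2^T,$$ where $\mathcal{P}$ is a partition of $[0,t]$ and the limit, which exists, is taken in $H$. Moreover, $(\tau,t)\mapsto X^\tau(t)$ belongs to $\mathcal{V}^{(\gamma,\eta)}(\Delta_2^T,H)$.
   Context: $T>0$, $H$ is a separable Hilbert space with norm $|\cdot|_H$, $\mathcal{L}(H)$ the bounded linear operators on $H$ with operator norm $\|\cdot\|_{op}$, $\Delta_n^T:=\{(s_1,\dots,s_n)\in[0,T]^n:s_1\ge\dots\ge s_n\}$, $a\wedge b=\min(a,b)$; $\mathcal{C}^\gamma([0,T],H)$ is the space of $\gamma$-Hölder continuous functions $[0,T]\to H$; $|\mathcal{P}|$ is the mesh size of $\mathcal{P}$, and $[u,v]\in\mathcal{P}$ runs over its consecutive subintervals. Kernels: for $\eta\in(0,1)$, $\mathcal{K}_\eta$ is the space of Volterra kernels of order $\eta$, i.e. maps $K:\Delta_2^T\to\mathcal{L}(H)$ satisfying, for $(\tau,t,s,r)\in\Delta_4^T$, any $\theta,\nu\in[0,1]$ and every $f\in H$ (with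 $\lesssim$ meaning inequality up to a multiplicative constant), $|K(t,s)f|_H\lesssim|t-s|^{-\eta}|f|_H$; $|(K(t,s)-K(t,r))f|_H\lesssim|t-s|^{-\eta-\theta}|s-r|^\theta|f|_H$; $|(K(\tau,s)-K(t,s))f|_H\lesssim|t-s|^{-\eta-\theta}|\tau-t|^\theta|f|_H$; $|(K(\tau,s)-K(\tau,r)-K(t,s)+K(t,r))f|_H\lesssim|\tau-r|^{-\nu-\theta-\eta}|\tau-t|^\theta|r-s|^\nu|f|_H$. It is equipped with the semi-norm $\|K\|_{\mathcal{K}_\eta}:=\|K\|_{\eta,1}+\|K\|_{\eta,2}+\|K\|_{\eta,3}+\|K\|_{\eta,4}$, where $\|K\|_{\eta,1}=\sup_{(t,s)\in\Delta_2^T}\frac{\|K(t,s)\|_{op}}{|t-s|^{-\eta}}$, $\|K\|_{\eta,2}=\sup_{(t,u,s)\in\Delta_3^T,\ \theta\in[0,1]}\frac{\|K(t,s)-K(u,s)\|_{op}}{|t-u|^\theta|u-s|^{-\theta-\eta}}$, $\|K\|_{\eta,3}=\sup_{(t,u,s)\in\Delta_3^T,\ \theta\in[0,1]}\frac{\|K(t,u)-K(t,s)\|_{op}}{|u-s|^\theta|t-u|^{-\theta-\eta}}$, $\|K\|_{\eta,4}=\sup_{(\tau',\tau,s,r)\in\Delta_4^T,\ \theta,\nu\in[0,1]}\frac{\|K(\tau',s)-K(\tau',r)-K(\tau,s)+K(\tau,r)\|_{op}}{|\tau-r|^{-\nu-\theta-\eta}|\tau'-\tau|^\nu|r-s|^\theta}$.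 Volterra–Hölder space: for $\gamma,\eta\in(0,1)$ with $\gamma-\eta>0$, $\mathcal{V}^{(\gamma,\eta)}(\Delta_2^T,H)$ is the space of functions $f:\Delta_2^T\to H$, written $f^\tau(t)=f(\tau,t)$, with $\|f\|_{(\gamma,\eta)}:=\|f\|_{(\gamma,\eta),1}+\|f\|_{(\gamma,\eta),1,2}<\infty$, where $$\|f\|_{(\gamma,\eta),1}=\sup_{(\tau,t,s)\in\Delta_3^T}\frac{|f^\tau(t)-f^\tau(s)|_H}{[|\tau-t|^{-\eta}|t-s|^\gamma]\wedge|\tau-s|^{\gamma-\eta}},$$ $$\|f\|_{(\gamma,\eta),1,2}=\sup\frac{|f^{\tau'}(t)-f^\tau(t)-f^{\tau'}(s)+f^\tau(s)|_H}{|\tau'-\tau|^\theta|\tau-t|^{-\theta+\zeta}\{[|\tau-t|^{-\eta-\zeta}|t-s|^\gamma]\wedge|\tau-s|^{\gamma-\eta-\zeta}\}},$$ the last supremum being over $(\tau',\tau,t,s)\in\Delta_4^T$, $\theta\in[0,1]$ and $\zeta\in[0,\gamma-\eta)$.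
   Formalization: In the second Volterra–Hölder seminorm the supremum is taken only over pairs with ζ ≤ θ, since over all θ in [0,1] and ζ in [0,γ−η) it is infinite already for H=ℝ, K(τ,s)=τ, W(t)=t. *)

(* Defs.v *)
From HB Require Import structures.
From mathcomp Require Import all_boot all_order all_algebra.
From mathcomp Require Import mathcomp_extra boolp classical_sets functions.
From mathcomp Require Import cardinality reals ereal interval_inference.
From mathcomp Require Import topology normedtype sequences exp numfun.

Set Implicit Arguments.
Unset Strict Implicit.
Unset Printing Implicit Defensive.

Import Order.TTheory GRing.Theory Num.Theory.
Import numFieldNormedType.Exports.

Local Open Scope classical_set_scope.
Local Open Scope ring_scope.

Section hilbert.
Context {R : realType} (H : completeNormedModType R).

(* The norm and the topology are those of [H]; [ip] is a symmetric positive
   definite bilinear form, so this is a real Hilbert space.  A complex Hilbert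
   space and its operators are covered by restriction of scalars. *)
Definition hilbert : Prop :=
  exists ip : {dot H for idfun}, forall x : H, `|x| ^+ 2 = ip x x.

Definition separable_space : Prop := exists2 D : set H, countable D & dense D.

End hilbert.

Section powers.
Context {R : realType}.

(* |x|^p with the convention 0^p = +oo for p < 0, whereas [0 `^ p = 0] in the
   library; also 0^0 = 1.  Products and quotients of such powers are formed in
   [\bar R], where 0 * +oo = 0, x / +oo = 0, 0 / 0 = 0 and x / 0 = +oo for
   x > 0.  Hence a singular weight on the diagonal imposes no condition. *)
Definition spow (x p : R) : \bar R :=
  if (x == 0) && (p < 0) then +oo%E else (`|x| `^ p)%:E.

End powers.

Section volterra.
Context {R : realType} {H : normedModType R}.
Variable T : R.

(* Functions of points of a simplex are total functions on [R]; only their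
   values on the simplex matter. *)
Definition simplex (s : seq R) : bool :=
  all (fun x => 0 <= x <= T) s && sorted >=%R s.

Definition holder (gamma : R) (W : R -> H) : Prop :=
  exists C : R, forall s t, 0 <= s <= T -> 0 <= t <= T ->
    `|W t - W s| <= C * `|t - s| `^ gamma.

Definition volterra_kernel (eta : R) (K : R -> R -> {linear H -> H}) : Prop :=
  (forall t s, simplex [:: t; s] -> continuous (K t s)) /\
  exists C : R, 0 < C /\
    forall tau t s r theta nu (f : H), simplex [:: tau; t; s; r] ->
      0 <= theta <= 1 -> 0 <= nu <= 1 ->
  [/\ (`|K t s f|%:E <= C%:E * (spow (t - s) (- eta) * `|f|%:E))%E,
      (`|K t s f - K t r f|%:E <=
        C%:E * (spow (t - s) (- eta - theta) * spow (s - r) theta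
                * `|f|%:E))%E,
      (`|K tau s f - K t s f|%:E <=
        C%:E * (spow (t - s) (- eta - theta) * spow (tau - t) theta
                * `|f|%:E))%E
    & (`|K tau s f - K tau r f - K t s f + K t r f|%:E <=
        C%:E * (spow (tau - r) (- nu - theta - eta) * spow (tau - t) theta
                * spow (r - s) nu * `|f|%:E))%E].

Section volterra_holder_space.
Variables gamma eta : R.
Implicit Type f : R -> R -> H.

Definition vh_norm1 f : \bar R :=
  ereal_sup [set q | exists tau t s, simplex [:: tau; t; s] /\
    q = (`|f tau t - f tau s|%:E /
         mine (spow (tau - t) (- eta) * spow (t - s) gamma)
              (spow (tau - s) (gamma - eta)))%E].

(* The weight carries the factor |tau - t|^(-theta + zeta), and the pairs
   (theta, zeta) are those for which this exponent is nonpositive.  For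
   theta < zeta the weight vanishes as tau decreases to t > s, and the supremum
   would be +oo already for f tau t = (tau t) x with x <> 0, the integral of
   the kernel K(tau, s) = tau Id against W(t) = t x. *)
Definition vh_norm12 f : \bar R :=
  ereal_sup [set q | exists tau' tau t s theta zeta,
    [/\ simplex [:: tau'; tau; t; s], 0 <= theta <= 1,
        0 <= zeta < gamma - eta, zeta <= theta &
    q = (`|f tau' t - f tau t - f tau' s + f tau s|%:E /
         (spow (tau' - tau) theta * spow (tau - t) (- theta + zeta) *
          mine (spow (tau - t) (- eta - zeta) * spow (t - s) gamma)
               (spow (tau - s) (gamma - eta - zeta))))%E]].

Definition vh_norm f : \bar R := (vh_norm1 f + vh_norm12 f)%E.

Definition volterra_holder f : Prop := (vh_norm f < +oo)%E.

End volterra_holder_space.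

End volterra.

Section integral.
Context {R : realType}.

(* As in [itv_partition], a partition of [a, b] is [a :: s] with [s] strictly
   increasing, from [a] (excluded) to [b]. *)
Definition subintervals (a : R) (s : seq R) : seq (R * R) := zip (a :: s) s.

Definition mesh (a : R) (s : seq R) : R :=
  \big[Num.max/0]_(p <- subintervals a s) (p.2 - p.1).

Definition mesh_to0 (a b : R) : set_system (seq R) :=
  [set A | exists2 delta : R, 0 < delta &
    forall s, itv_partition a b s -> mesh a s < delta -> A s].

Global Instance mesh_to0_filter a b : Filter (mesh_to0 a b).
Proof.
split.
- by exists 1.
- move=> A B [d1 d10 hA] [d2 d20 hB]; exists (Num.min d1 d2).
    by rewrite lt_min d10.
  by move=> s hs; rewrite lt_min => /andP[h1 h2]; split; [apply: hA|apply: hB].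
- by move=> A B AB [d d0 hA]; exists d => // s hs hm; apply/AB/hA.
Qed.

Lemma mesh_to0_proper a b : a <= b -> ProperFilter (mesh_to0 a b).
Proof.
move=> ab; split; last exact: mesh_to0_filter.
case=> d d0 /= H0.
have d20 : 0 < d / 2 by rewrite divr_gt0.
have d2d : d / 2 < d by rewrite ltr_pdivrMr// ltr_pMr// ltr1n.
have fine_partition n a' : a' <= b -> b - a' < d / 2 * n%:R ->
    exists2 s, itv_partition a' b s & mesh a' s < d.
  elim: n a' => [|n IH] a' ab'.
    by rewrite mulr0 subr_lt0 => /(le_lt_trans ab'); rewrite ltxx.
  have [h|h] := ltP (b - a') d => hn.
    move: ab'; rewrite le_eqVlt => /orP[/eqP ->|ab'].
      by exists [::]; [split => /=|rewrite /mesh /subintervals big_nil].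
    exists [:: b]; first exact: itv_partition1.
    by rewrite /mesh /subintervals/= big_cons big_nil gt_max h d0.
  have [||s hs ms] := IH (a' + d / 2).
  - by rewrite addrC -lerBrDr (le_trans (ltW d2d)).
  - by rewrite opprD addrA ltrBlDr (lt_le_trans hn)// -[n.+1%:R]natr1 mulrDr mulr1.
  exists (a' + d / 2 :: s).
    by case: hs => h1 h2; split => //=; rewrite h1 ltrDl d20.
  by rewrite /mesh /subintervals/= big_cons gt_max/= addrAC subrr add0r d2d.
have [s hs ms] : exists2 s, itv_partition a b s & mesh a s < d.
  apply: (fine_partition (Num.bound ((b - a) / (d / 2)))) => //.
  by rewrite mulrC -ltr_pdivrMr// archi_boundP// divr_ge0 ?subr_ge0// ltW.
exact: H0 hs ms.
Qed.

Context {H : normedModType R}.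

Definition riemann_sum (Xi : R -> R -> H) (a : R) (s : seq R) : H :=
  \sum_(p <- subintervals a s) Xi p.2 p.1.

Definition volterra_germ (K : R -> R -> {linear H -> H}) (W : R -> H)
    (tau t s : R) : H :=
  K tau s (W t - W s).

Definition volterra_integral (K : R -> R -> {linear H -> H}) (W : R -> H)
    (tau t : R) : H :=
  lim (riemann_sum (volterra_germ K W tau) 0 @ mesh_to0 0 t).

End integral.

(* Main.v *)
(* Young's sewing argument with singular controls.  If the defect
   Xi(v,u) - Xi(m,u) - Xi(v,m) is at most M (g v - g u)^p with g nondecreasing
   and p > 1, then every Riemann sum over [s,t] differs from Xi(t,s) by at most
   C_p M (g t - g s)^p; comparison with a common refinement gives convergence
   when g is uniformly continuous.  Take p = 1 + gamma.  For the germ of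
   K(tau,.), the control -(tau - r)^rho with rho = (gamma - eta) / p absorbs the
   singularity at r = tau, and gamma > eta makes it continuous there.  For the
   difference of the germs at tau' > tau, write e = tau' - t: if t - s <= e the
   kernel is regular at the scale t - s and g r = r suffices, and otherwise the
   control (tau' - r)^(-sigma) with sigma = (1 + eta - gamma) / p yields
   (tau' - tau) e^(gamma - eta - 1).  Each bound so obtained is a multiple of
   (tau' - tau)^theta e^(- theta - eta) w^gamma with w <= t - s and
   tau - t <= e >= w, uniformly in theta, and any such quantity is dominated by
   the weights of the Volterra-Hoelder norm. *)
Require Import Defs.
From HB Require Import structures.
From mathcomp Require Import all_boot all_order all_algebra ring lra.
From mathcomp Require Import mathcomp_extra boolp classical_sets functions.
From mathcomp Require Import cardinality reals ereal interval_inference.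
From mathcomp Require Import topology normedtype sequences exp numfun.

Set Implicit Arguments.
Unset Strict Implicit.
Unset Printing Implicit Defensive.

Import Order.TTheory GRing.Theory Num.Theory.
Import numFieldNormedType.Exports.

Local Open Scope classical_set_scope.
Local Open Scope ring_scope.

(** * Tangent inequalities and subadditivity of real powers *)

Section real_powers.
Context {R : realType}.
Implicit Types (x y r p : R).

Lemma powRD_gt0 x r p : 0 < x -> x `^ (r + p) = x `^ r * x `^ p.
Proof. by move=> x0; rewrite powRD// (gt_eqF x0) implybT. Qed.

Lemma le_powRN x y p : 0 <= p -> 0 < x -> x <= y -> y `^ (- p) <= x `^ (- p).
Proof.
move=> p0 x0 xy; have y0 := lt_le_trans x0 xy.
by rewrite !powRN lef_pV2 ?posrE ?powR_gt0// ge0_ler_powR// nnegrE ltW.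
Qed.

Lemma le_powR x y p : 0 <= p -> 0 <= x -> x <= y -> x `^ p <= y `^ p.
Proof.
by move=> p0 x0 xy; rewrite ge0_ler_powR// nnegrE// (le_trans x0).
Qed.

(** With L = ln x, both x and 1 are x^p times an exponential, of (1 - p) L and of - p L
    respectively. Bounding each exponential below by 1 + y and averaging with weights p and 1 - p
    cancels L. *)
Lemma powR_bernoulli x p : 0 < x -> 0 <= p <= 1 -> x `^ p <= 1 + p * (x - 1).
Proof.
move=> x0 /andP[p0 p1]; set L := ln x.
have xE : x = x `^ p * expR ((1 - p) * L).
  rewrite /powR gt_eqF// -expRD -mulrDl addrCA subrr addr0 mul1r.
  by rewrite lnK// posrE.
have xNE : x `^ p * expR (- (p * L)) = 1.
  by rewrite /powR gt_eqF// -expRD subrr expR0.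
have xp := powR_gt0 p x0.
have h1 := expR_ge1Dx ((1 - p) * L).
have h2 := expR_ge1Dx (- (p * L)).
have e1 : x `^ p * (1 + (1 - p) * L) <= x.
  by rewrite [leRHS]xE ler_pM2l.
have e2 : x `^ p * (1 - p * L) <= 1 by rewrite -[leRHS]xNE ler_pM2l.
have q0 : 0 <= 1 - p by lra.
have := ler_wpM2l p0 e1; have := ler_wpM2l q0 e2; lra.
Qed.

Lemma powR_bernoulli_npos x p : 0 < x -> 0 <= p ->
  1 - p * (x - 1) <= x `^ (- p).
Proof.
move=> x0 p0; rewrite /powR gt_eqF//.
have := expR_ge1Dx (- p * ln x); have := ln_sublinear x0.
have := expR_ge1Dx (ln x); rewrite lnK ?posrE//; nra.
Qed.

(** Concavity: Bernoulli's inequality at y / x, rescaled by x^p, is the tangent line at x. *)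
Lemma powR_tangent_le x y p : 0 < x -> 0 <= y -> 0 < p <= 1 ->
  y `^ p <= x `^ p + p * x `^ (p - 1) * (y - x).
Proof.
move=> x0; rewrite le_eqVlt => /predU1P[<-|y0] /andP[p0 p1].
  rewrite powR0 ?gt_eqF// sub0r mulrN -mulrA [_ * x]mulrC.
  by rewrite mulr_powRB1 ?(ltW x0)// subr_ge0 ger_pMl// powR_gt0.
have := @powR_bernoulli (y / x) p; rewrite divr_gt0// (ltW p0) p1.
move=> /(_ isT isT).
have xp := powR_gt0 p x0.
have -> : (y / x) `^ p = y `^ p / x `^ p.
  by rewrite powRM ?invr_ge0 ?ltW// -powR_inv1 ?ltW// -powRrM mulN1r powRN.
rewrite ler_pdivrMr// => /le_trans; apply.
rewrite powRD_gt0// powR_inv1 ?(ltW x0)// le_eqVlt; apply/orP; left; apply/eqP.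
by field; rewrite gt_eqF.
Qed.

Lemma powR_tangent_ge x y p : 0 < x -> 0 < y -> 0 <= p ->
  x `^ (- p) - p * x `^ (- p - 1) * (y - x) <= y `^ (- p).
Proof.
move=> x0 y0 p0; have := powR_bernoulli_npos (divr_gt0 y0 x0) p0.
have xp := powR_gt0 p x0.
have -> : (y / x) `^ (- p) = y `^ (- p) * x `^ p.
  by rewrite powRM ?invr_ge0 ?ltW// -[x^-1]powR_inv1 ?ltW// -powRrM mulN1r opprK.
rewrite -ler_pdivrMr// => /(le_trans _); apply.
rewrite powRD_gt0// powRN powR_inv1 ?(ltW x0)// le_eqVlt; apply/orP; left; apply/eqP.
by field; rewrite !gt_eqF.
Qed.

(** Since p - 1 <= 0, both terms of (x + y)^p = x (x + y)^(p - 1) + y (x + y)^(p - 1) grow when the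
    base x + y is lowered to x or to y. *)
Lemma powRD_le x y p : 0 <= x -> 0 <= y -> 0 < p <= 1 ->
  (x + y) `^ p <= x `^ p + y `^ p.
Proof.
move=> x0 y0 /andP[p0 p1].
have aux u v : 0 <= u -> u <= v -> u * v `^ (p - 1) <= u `^ p.
  rewrite le_eqVlt => /predU1P[<-|u0] uv; first by rewrite mul0r powR_ge0.
  rewrite -(mulr_powRB1 (ltW u0) p0) ler_pM2l// -opprB.
  by rewrite le_powRN ?subr_ge0.
rewrite -(mulr_powRB1 (addr_ge0 x0 y0) p0) mulrDl.
by rewrite lerD ?aux ?lerDl ?lerDr.
Qed.

End real_powers.

(** * Riemann sums and mesh along concatenated partitions *)

Section partitions.
Context {R : realType} {H : normedModType R}.
Implicit Types (Xi : R -> R -> H) (a b : R) (s : seq R).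

Lemma riemann_sum_nil Xi a : riemann_sum Xi a [::] = 0.
Proof. by rewrite /riemann_sum /subintervals /= big_nil. Qed.

Lemma riemann_sum_cons Xi a b s :
  riemann_sum Xi a (b :: s) = Xi b a + riemann_sum Xi b s.
Proof. by rewrite /riemann_sum /subintervals /= big_cons. Qed.

Lemma riemann_sum_cat Xi a s1 s2 :
  riemann_sum Xi a (s1 ++ s2) =
  riemann_sum Xi a s1 + riemann_sum Xi (last a s1) s2.
Proof.
elim: s1 a => [|b s1 IH] a /=; first by rewrite riemann_sum_nil add0r.
by rewrite !riemann_sum_cons IH addrA.
Qed.

Lemma riemann_sumB Xi1 Xi2 a s :
  riemann_sum (fun v u => Xi1 v u - Xi2 v u) a s =
  riemann_sum Xi1 a s - riemann_sum Xi2 a s.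
Proof. by rewrite /riemann_sum big_split /= sumrN. Qed.

Lemma mesh_nil a : mesh a [::] = 0.
Proof. by rewrite /mesh /subintervals /= big_nil. Qed.

Lemma mesh_cons a b s : mesh a (b :: s) = Num.max (b - a) (mesh b s).
Proof. by rewrite /mesh /subintervals /= big_cons. Qed.

Lemma mesh_ge0 a s : 0 <= mesh a s.
Proof.
by elim: s a => [|b s IH] a; rewrite ?mesh_nil// mesh_cons le_max IH orbT.
Qed.

Lemma mesh_cat a s1 s2 :
  mesh a (s1 ++ s2) = Num.max (mesh a s1) (mesh (last a s1) s2).
Proof.
elim: s1 a => [|b s1 IH] a /=; last by rewrite !mesh_cons IH maxA.
by rewrite mesh_nil; apply/esym/max_idPr; exact: mesh_ge0.
Qed.

Lemma path_lt_last a s : path <%R a s -> a <= last a s.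
Proof.
elim: s a => [|b s IH] a //= /andP[ab /IH]; exact: (le_trans (ltW ab)).
Qed.

Lemma path_lt_mem a s x : path <%R a s -> x \in s -> a < x <= last a s.
Proof.
move=> + /splitPr xs; case: xs => s1 s2.
rewrite cat_path last_cat /= => /and3P[h1 h2 h3].
by rewrite (le_lt_trans (path_lt_last h1) h2) path_lt_last.
Qed.

End partitions.

(** * The constant of the sewing bound *)

Section sewing_constant.
Context {R : realType}.
Implicit Type p : R.

Definition sewing_const p : R := 2 / (1 - 2 `^ (1 - p)).

Lemma powR2_lt1 p : 1 < p -> 2 `^ (1 - p) < 1 :> R.
Proof.
move=> p1; rewrite /powR gt_eqF// -[ltRHS]expR0 ltr_expR pmulr_llt0 ?subr_lt0//.
by rewrite ln_gt0// ltr1n.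
Qed.

Lemma sewing_const_gt0 p : 1 < p -> 0 < sewing_const p.
Proof. by move=> p1; rewrite divr_gt0// subr_gt0 powR2_lt1. Qed.

(* The recursion solved by [sewing_const]: two halves and two defects. *)
Lemma sewing_constE p : 1 < p ->
  sewing_const p * 2 `^ (1 - p) + 2 = sewing_const p.
Proof.
move=> p1; rewrite /sewing_const; field.
by rewrite subr_eq0 gt_eqF ?powR2_lt1.
Qed.

Lemma powR_half p x : 0 <= x -> (x / 2) `^ p *+ 2 = 2 `^ (1 - p) * x `^ p.
Proof.
move=> x0; rewrite powRM// -powR_inv1// -powRrM mulN1r powRD_gt0// powRr1//.
by rewrite -mulr_natl; ring.
Qed.

End sewing_constant.

(** The cut is made at the first point of [s] satisfying [P]. With [P] saying that half of the
    increment of the control is reached, the interval ending at [v] carries the midpoint. *)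
Lemma path_split {T : eqType} (P : pred T) c s : P (last c s) -> s != [::] ->
  exists s1 v s2, [/\ s = s1 ++ v :: s2, P v & s1 = [::] \/ ~~ P (last c s1)].
Proof.
elim: s c => //= w s IH c Pl _.
have [Pw|nPw] := boolP (P w); first by exists [::], w, s; split => //; left.
have [s0|s0] := eqVneq s [::]; first by move: Pl nPw; rewrite s0 /= => ->.
have [s1 [v [s2 [-> Pv h]]]] := IH w Pl s0.
exists (w :: s1), v, s2; split => //=; right.
by case: h => [->|].
Qed.

(** * Sewing bounds for Riemann sums *)

Section sewing.
Context {R : realType} {H : normedModType R}.

(** The additive control g v - g u acts as a clock: measured in it, the defect has order p even
    where the germ is singular in time. *)
Definition germ_control (Xi : R -> R -> H) (g : R -> R) (p M a b : R) :=
  [/\ forall u v, a <= u -> u <= v -> v <= b -> g u <= g v,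
      forall u, Xi u u = 0
    & forall u m v, a <= u -> u <= m -> m <= v -> v <= b ->
        `|Xi v u - Xi m u - Xi v m| <= M * (g v - g u) `^ p].

Variables (Xi : R -> R -> H) (g : R -> R) (p M a b : R).
Hypothesis p1 : 1 < p.
Hypothesis M0 : 0 <= M.
Hypothesis XiP : germ_control Xi g p M a b.

Let g_mono : forall u v, a <= u -> u <= v -> v <= b -> g u <= g v.
Proof. by case: XiP. Qed.

Let Xi_diag : forall u, Xi u u = 0.
Proof. by case: XiP. Qed.

Let Xi_sewing : forall u m v, a <= u -> u <= m -> m <= v -> v <= b ->
  `|Xi v u - Xi m u - Xi v m| <= M * (g v - g u) `^ p.
Proof. by case: XiP. Qed.

(* Cutting at the interval carrying the midpoint of [g] leaves two partitions
   on which [g] increases by at most half of its total increment. *)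
Lemma sewing_bound c s : a <= c -> path <%R c s -> last c s <= b ->
  `|riemann_sum Xi c s - Xi (last c s) c| <=
    sewing_const p * M * (g (last c s) - g c) `^ p.
Proof.
have [n] := ubnP (size s); elim: n s c => // n IH s c /ltnSE sn ac cs lb.
have K0 := ltW (sewing_const_gt0 p1); have p0 : 0 <= p := ltW (lt_trans ltr01 p1).
have [->|s0] := eqVneq s [::].
  rewrite riemann_sum_nil /= Xi_diag subr0 normr0.
  by rewrite mulr_ge0 ?powR_ge0 ?(mulr_ge0 K0 M0).
set G := g (last c s) - g c.
have G0 : 0 <= G by rewrite subr_ge0 g_mono// path_lt_last.
pose P x := g c + G / 2 <= g x.
have Pl : P (last c s) by move: G0; rewrite /P /G; lra.
have [s1 [v [s2 [sE Pv s1P]]]] := path_split Pl s0.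
move: cs lb sn; rewrite sE cat_path last_cat /= size_cat /= => /and3P[cs1 uv vs2].
move=> lb sn.
set u := last c s1 in s1P uv *; set z := last v s2 in lb *.
have cu : c <= u := path_lt_last cs1.
have vz : v <= z := path_lt_last vs2.
have au : a <= u := le_trans ac cu.
have vb : v <= b := le_trans vz lb.
have GE : G = g z - g c by rewrite /G sE last_cat.
have Gu : g u - g c <= G / 2.
  (* An empty [s1] means u = c, so the increment of [g] on the left is zero. *)
  case: s1P => [s1E|]; first by rewrite /u s1E /= subrr divr_ge0.
  by rewrite /P -ltNge; lra.
have Gv : g z - g v <= G / 2 by move: Pv; rewrite /P; lra.
have gcu : g c <= g u by apply: g_mono => //; lra.
have gvz : g v <= g z by apply: g_mono => //; lra.
have h1 : `|riemann_sum Xi c s1 - Xi u c| <= sewing_const p * M * (G / 2) `^ p.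
  apply: le_trans (IH _ _ _ ac cs1 _) _; rewrite -/u.
  - by rewrite (leq_trans _ sn)// addnS ltnS leq_addr.
  - by lra.
  - by rewrite ler_wpM2l ?(mulr_ge0 K0 M0)// le_powR//; lra.
have h2 : `|riemann_sum Xi v s2 - Xi z v| <= sewing_const p * M * (G / 2) `^ p.
  apply: le_trans (IH _ _ _ _ vs2 _) _; rewrite -/z.
  - by rewrite (leq_trans _ sn)// addnS ltnS leq_addl.
  - by lra.
  - by [].
  - by rewrite ler_wpM2l ?(mulr_ge0 K0 M0)// le_powR//; lra.
have h3 : `|Xi z c - Xi u c - Xi z u| <= M * G `^ p.
  by rewrite GE; apply: Xi_sewing => //; lra.
have h4 : `|Xi z u - Xi v u - Xi z v| <= M * G `^ p.
  apply: le_trans (Xi_sewing _ _ _ _) _ => //; first lra.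
  by rewrite ler_wpM2l// le_powR//; lra.
rewrite riemann_sum_cat -/u riemann_sum_cons.
(* The defects come from cutting [c, z] at u and then [u, z] at v, which isolates the term of the
   middle interval. *)
move: h3 h4; move dE : (Xi z c - _ - _) => d; move d'E : (Xi z u - _ - _) => d'.
move=> h3 h4.
have -> : riemann_sum Xi c s1 + (Xi v u + riemann_sum Xi v s2) - Xi z c =
  (riemann_sum Xi c s1 - Xi u c) + (riemann_sum Xi v s2 - Xi z v) - d - d'.
  have -> : Xi z c = d + Xi z u + Xi u c by rewrite -dE !subrK.
  have -> : Xi z u = d' + Xi z v + Xi v u by rewrite -d'E !subrK.
  by rewrite !opprD !addrA [LHS](ACl (1*8*3*6*4*5*(2*7))) /= subrr addr0.
(* The two halves give 2 (G / 2)^p = 2^(1 - p) G^p, so [sewing_constE] closes the induction with the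
   same constant. *)
have -> : sewing_const p * M * G `^ p = sewing_const p * M * (G / 2) `^ p +
    sewing_const p * M * (G / 2) `^ p + M * G `^ p + M * G `^ p.
  rewrite -mulrDr -mulr2n powR_half// -{1}(sewing_constE p1); ring.
apply: le_trans (ler_normB _ _) _; apply: lerD => //.
apply: le_trans (ler_normB _ _) _; apply: lerD => //.
by apply: le_trans (ler_normD _ _) _; apply: lerD.
Qed.

(** On each interval of [s], [sewing_bound] compares the part of [s'] inside it with a single germ
    term. Of the p-th power of the increment, e^(p - 1) is taken out and one factor is kept; these
    factors telescope. *)
Lemma riemann_sum_refine e c s s' : a <= c -> path <%R c s -> path <%R c s' ->
  last c s = last c s' -> last c s <= b -> {subset s <= s'} ->
  (forall q, q \in subintervals c s -> g q.2 - g q.1 <= e) ->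
  `|riemann_sum Xi c s' - riemann_sum Xi c s| <=
    sewing_const p * M * e `^ (p - 1) * (g (last c s) - g c).
Proof.
have K0 := ltW (sewing_const_gt0 p1).
have p10 : 0 <= p - 1 by rewrite subr_ge0 ltW.
elim: s c s' => [|v s IH] c s' ac.
  move=> _ cs' /= cl _ _ _.
  have /itv_partitionxx -> : itv_partition c c s' by split=> //; rewrite -cl.
  by rewrite subrr normr0 subrr mulr0.
move=> /= /andP[cv vs] cs' ls lb ss he.
have : v \in s' by apply: ss; rewrite mem_head.
move=> vs'; move: cs' ls ss; case/splitPr: vs' => s1 s2.
rewrite -cat_rcons cat_path last_cat last_rcons => /andP[cs1 vs2] ls ss.
have vb : v <= b by rewrite (le_trans _ lb)// path_lt_last.
have gcv : g c <= g v by apply: g_mono => //; exact: ltW.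
have h1 : `|riemann_sum Xi c (rcons s1 v) - Xi v c| <=
    sewing_const p * M * e `^ (p - 1) * (g v - g c).
  have := sewing_bound ac cs1; rewrite last_rcons => /(_ vb) /le_trans; apply.
  rewrite -[leRHS]mulrA ler_wpM2l ?(mulr_ge0 K0 M0)// -mulr_powRB1 ?subr_ge0//; last first.
    exact: lt_trans ltr01 p1.
  rewrite mulrC ler_wpM2r ?subr_ge0//; apply: le_powR; rewrite ?(subr_ge0 (g c))//.
  by apply: (he (c, v)); rewrite mem_head.
have h2 : `|riemann_sum Xi v s2 - riemann_sum Xi v s| <=
    sewing_const p * M * e `^ (p - 1) * (g (last v s) - g v).
  apply: IH => //; first exact: le_trans ac (ltW cv).
    (* A point of [s] lies beyond [v], so in [s'] it can only come from the part after [v]. *)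
    move=> x xs; have := ss x; rewrite inE xs orbT mem_cat => /(_ isT).
    case/orP => // /(path_lt_mem cs1); rewrite last_rcons.
    by have /andP[vx _] := path_lt_mem vs xs; rewrite leNgt vx andbF.
  by move=> q qs; apply: he; rewrite inE qs orbT.
rewrite riemann_sum_cat last_rcons riemann_sum_cons opprD addrACA.
apply: le_trans (ler_normD _ _) _; apply: le_trans (lerD h1 h2) _.
by rewrite -mulrDr addrA addrAC -[_ - g c + _]addrA addrCA subrr addr0 addrC.
Qed.

End sewing.

(** * Common refinements and intervals of partitions *)

Section common_refinement.
Context {R : realType}.
Implicit Types (a b : R) (s : seq R).

Lemma common_refinement a b s1 s2 :
  itv_partition a b s1 -> itv_partition a b s2 -> exists s,
  [/\ itv_partition a b s, {subset s1 <= s} & {subset s2 <= s}].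
Proof.
move=> [p1 /eqP l1] [p2 /eqP l2].
pose s := sort <=%R (undup (s1 ++ s2)).
have sE x : x \in s = (x \in s1) || (x \in s2).
  by rewrite mem_sort mem_undup mem_cat.
have sab x : x \in s -> a < x <= b.
  by rewrite sE => /orP[/(path_lt_mem p1)|/(path_lt_mem p2)]; rewrite ?l1 ?l2.
have ps : path <%R a s.
  rewrite lt_path_sortedE sort_lt_sorted undup_uniq andbT.
  by apply/allP => x /sab /andP[].
exists s; split; last 2 first.
  by move=> x xs; rewrite sE xs.
  by move=> x xs; rewrite sE xs orbT.
split=> //; rewrite eq_le; apply/andP; split.
  have := mem_last a s; rewrite inE => /orP[/eqP ->|/sab/andP[]//].
  by rewrite -l1 path_lt_last.
have := mem_last a s1; rewrite l1 inE => /orP[/eqP ->|bs1].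
  exact: path_lt_last.
by have /andP[] : a < b <= last a s by apply: path_lt_mem => //; rewrite sE bs1.
Qed.

Lemma mesh_subintervals a s q : q \in subintervals a s -> q.2 - q.1 <= mesh a s.
Proof.
elim: s a => [|b s IH] a //; rewrite mesh_cons le_max.
rewrite /subintervals /= inE => /orP[/eqP ->|/IH ->]; first by rewrite lexx.
by rewrite orbT.
Qed.

Lemma subintervals_itv a s q : path <%R a s -> q \in subintervals a s ->
  [/\ a <= q.1, q.1 < q.2 & q.2 <= last a s].
Proof.
elim: s a => [|b s IH] a //= /andP[ab bs].
rewrite /subintervals /= inE => /orP[/eqP ->|/(IH _ bs)[h1 h2 h3]].
  by rewrite ab lexx path_lt_last.
by rewrite h2 h3 (le_trans (ltW ab) h1).
Qed.

Lemma near_mesh a b d : 0 < d ->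
  mesh_to0 a b [set s | itv_partition a b s /\ mesh a s < d].
Proof. by move=> d0; exists d. Qed.

End common_refinement.

Lemma germ_control_sub {R : realType} {H : normedModType R}
    (Xi : R -> R -> H) g p M a b b' :
  b' <= b -> germ_control Xi g p M a b -> germ_control Xi g p M a b'.
Proof.
move=> bb [h1 h2 h3]; split=> // [u v u0 uv vb|u m v u0 um mv vb].
  by apply: h1 => //; exact: le_trans bb.
by apply: h3 => //; exact: le_trans bb.
Qed.

(** * Convergence of Riemann sums and increments of the limit *)

Section sewing_limit.
Context {R : realType} {H : completeNormedModType R}.
Variables (Xi : R -> R -> H) (a : R).

(** Cauchy criterion: two partitions of small mesh are each close to their common refinement,
    because uniform continuity of [g] turns a small mesh into small increments of the control. *)
Lemma sewing_cvg (g : R -> R) (p M b : R) : 1 < p -> 0 <= M -> a <= b ->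
  germ_control Xi g p M a b ->
  (forall e, 0 < e -> exists2 d, 0 < d & forall u v, a <= u -> u < v -> v <= b ->
     v - u < d -> g v - g u <= e) ->
  cvg (riemann_sum Xi a @ mesh_to0 a b).
Proof.
move=> p1 M0 ab XiP g_unif.
have FF := mesh_to0_proper ab.
apply: cauchy_cvg; apply: cauchy_exP => e e0.
have K0 := ltW (sewing_const_gt0 p1).
have gab : 0 <= g b - g a by case: XiP => h _ _; rewrite subr_ge0 h.
(* The summand 1 keeps D positive and makes the bound below equal to e / 2 times (D - 1) / D,
   strictly less than e / 2. *)
pose D := sewing_const p * M * (g b - g a) + 1.
have D1 : 1 <= D by rewrite lerDr (mulr_ge0 (mulr_ge0 K0 M0)).
have D0 : 0 < D := lt_le_trans ltr01 D1.
pose c := (e / 2 / D) `^ (p - 1)^-1.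
have c0 : 0 < c by rewrite powR_gt0// !divr_gt0.
have cE : c `^ (p - 1) = e / 2 / D.
  rewrite /c -powRrM mulVf ?subr_eq0 ?gt_eqF// powRr1//.
  by rewrite ltW// !divr_gt0.
have [d d0 gd] := g_unif c c0.
have bound s s' : itv_partition a b s -> mesh a s < d -> itv_partition a b s' ->
    {subset s <= s'} -> `|riemann_sum Xi a s' - riemann_sum Xi a s| < e / 2.
  move=> [ps /eqP ls] ms [ps' /eqP ls'] ss.
  have := riemann_sum_refine (e := c) p1 M0 XiP (lexx a) ps ps'.
  rewrite ls ls' => /(_ erefl (lexx b) ss) h.
  apply: le_lt_trans (h _) _.
    move=> q qs; have [h1 h2] := subintervals_itv ps qs; rewrite ls => h3.
    by apply: gd => //; apply: le_lt_trans ms; exact: mesh_subintervals.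
  rewrite cE [ltLHS](_ : _ = e / 2 * ((D - 1) / D)); last first.
    by rewrite /D addrK; ring.
  by rewrite gtr_pMr ?divr_gt0// ltr_pdivrMr// mul1r ltrBlDr ltrDl.
have [s0 [ps0 ms0]] := filter_ex (near_mesh a b d0).
exists (riemann_sum Xi a s0).
apply: filterS (near_mesh a b d0) => s [ps ms].
have [s' [ps' ss0 ss]] := common_refinement ps0 ps.
rewrite /= -ball_normE /=.
have h1 := bound _ _ ps0 ms0 ps' ss0; have h2 := bound _ _ ps ms ps' ss.
rewrite -(subrKA (riemann_sum Xi a s')) [e]splitr.
by apply: le_lt_trans (ler_normD _ _) _; rewrite ltrD// distrC.
Qed.

(** A fine partition of [a, s] followed by a fine one of [s, t] is a fine partition of [a, t], and
    the sums add. The bound on sums over [s, t] thus passes to the difference of the limits. *)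
Lemma lim_riemann_sum_increment (s t B : R) : a <= s -> s <= t ->
  cvg (riemann_sum Xi a @ mesh_to0 a s) ->
  cvg (riemann_sum Xi a @ mesh_to0 a t) ->
  (forall r, itv_partition s t r -> `|riemann_sum Xi s r - Xi t s| <= B) ->
  `|lim (riemann_sum Xi a @ mesh_to0 a t) -
    lim (riemann_sum Xi a @ mesh_to0 a s) - Xi t s| <= B.
Proof.
move=> as_ st cs ct hB.
have Fs := mesh_to0_proper as_; have Fst := mesh_to0_proper st.
have Ft := mesh_to0_proper (le_trans as_ st).
set Lt := lim _; set Ls := lim _.
apply/ler_addgt0Pr => e e0; have e20 : 0 < e / 2 by rewrite divr_gt0.
have /cvgrPdist_lt/(_ _ e20)[d d0 hd] : riemann_sum Xi a @ mesh_to0 a t --> Lt by [].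
have /cvgrPdist_lt/(_ _ e20) hs : riemann_sum Xi a @ mesh_to0 a s --> Ls by [].
have [r1 [h1 [[p1 /eqP l1] m1]]] := filter_ex (filterI hs (near_mesh a s d0)).
have [r2 [[p2 /eqP l2] m2]] := filter_ex (near_mesh s t d0).
have h3 : `|Lt - riemann_sum Xi a (r1 ++ r2)| < e / 2.
  apply: hd; first by split; rewrite ?cat_path ?last_cat l1 ?l2 ?p1.
  by rewrite mesh_cat l1 gt_max m1.
have h2 : `|riemann_sum Xi s r2 - Xi t s| <= B by apply: hB; split=> //; rewrite l2.
move: h3; rewrite riemann_sum_cat l1 => h3.
have -> : Lt - Ls - Xi t s =
    (Lt - (riemann_sum Xi a r1 + riemann_sum Xi s r2))
    - (Ls - riemann_sum Xi a r1) + (riemann_sum Xi s r2 - Xi t s).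
  by rewrite opprD opprB !addrA [RHS](ACl (1*5*7*(2*4)*(3*6))) /= addNr
    addNr !addr0.
apply: le_trans (ler_normD _ _) _; rewrite [leRHS]addrC lerD// [e]splitr.
apply: le_trans (ler_normB _ _) _.
by rewrite lerD// ltW.
Qed.

Lemma sewing_increment (g : R -> R) (p M s t : R) : 1 < p -> 0 <= M ->
  a <= s -> s <= t -> germ_control Xi g p M a t ->
  cvg (riemann_sum Xi a @ mesh_to0 a s) ->
  cvg (riemann_sum Xi a @ mesh_to0 a t) ->
  `|lim (riemann_sum Xi a @ mesh_to0 a t) -
    lim (riemann_sum Xi a @ mesh_to0 a s) - Xi t s| <=
    sewing_const p * M * (g t - g s) `^ p.
Proof.
move=> p1 M0 as_ st XiP cs ct.
apply: lim_riemann_sum_increment => // r [pr /eqP lr].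
by have := sewing_bound p1 M0 XiP as_ pr; rewrite lr; apply.
Qed.

End sewing_limit.

(** * Kernel and path estimates in real powers *)

Section kernel_bounds.
Context {R : realType}.

Lemma spow_pos (x q : R) : 0 < x -> spow x q = (x `^ q)%:E.
Proof. by move=> x0; rewrite /spow gt_eqF//= gtr0_norm. Qed.

Lemma spow_nneg (x q : R) : 0 <= x -> 0 <= q -> spow x q = (x `^ q)%:E.
Proof. by move=> x0 q0; rewrite /spow ltNge q0 andbF ger0_norm. Qed.

Lemma spow_distC (x y q : R) : spow (x - y) q = spow (y - x) q.
Proof. by rewrite /spow distrC !subr_eq0 eq_sym. Qed.

Lemma spow_ge0 (x q : R) : (0 <= spow x q)%E.
Proof. by rewrite /spow; case: ifP => // _; rewrite lee_fin powR_ge0. Qed.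

Lemma spow0_neg (q : R) : q < 0 -> spow 0 q = +oo%E.
Proof. by move=> q0; rewrite /spow eqxx q0. Qed.

Context {H : normedModType R}.

(** Strict inequalities keep the singular bases positive, so the estimates can be stated in [R]. The
    fourth is taken at nu = 1, which yields a full power of s - r. *)
Definition kernel_bound (T eta C : R) (K : R -> R -> {linear H -> H}) := [/\
  forall t s f, 0 <= s -> s < t -> t <= T ->
    `|K t s f| <= C * (t - s) `^ (- eta) * `|f|,
  forall t s r theta f, 0 <= r -> r <= s -> s < t -> t <= T ->
    0 <= theta <= 1 ->
    `|K t s f - K t r f| <=
      C * ((t - s) `^ (- eta - theta) * (s - r) `^ theta) * `|f|,
  forall tau t s theta f, 0 <= s -> s < t -> t <= tau -> tau <= T ->
    0 <= theta <= 1 ->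
    `|K tau s f - K t s f| <=
      C * ((t - s) `^ (- eta - theta) * (tau - t) `^ theta) * `|f|
  & forall tau t s r theta f, 0 <= r -> r <= s -> s <= t -> t <= tau ->
    r < tau -> tau <= T -> 0 <= theta <= 1 ->
    `|K tau s f - K tau r f - K t s f + K t r f| <=
      C * ((tau - r) `^ (- 1 - theta - eta) * (tau - t) `^ theta * (s - r))
      * `|f|].

Lemma volterra_kernel_bound (T eta : R) (K : R -> R -> {linear H -> H}) :
  volterra_kernel T eta K -> exists2 C, 0 <= C & kernel_bound T eta C K.
Proof.
move=> [_ [C [C0 hK]]]; exists C; first exact: ltW.
have unit0 : 0 <= (0 : R) <= 1 by rewrite lexx ler01.
split.
- move=> t s f s0 st tT.
  have S : simplex T [:: t; t; s; s].
    by rewrite /simplex /= lexx; apply/and5P; split; lra.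
  have [+ _ _ _] := hK _ _ _ _ 0 0 f S unit0 unit0.
  by rewrite spow_pos ?subr_gt0// -!EFinM lee_fin mulrA.
- move=> t s r theta f r0 rs st tT th.
  have S : simplex T [:: t; t; s; r].
    by rewrite /simplex /= lexx; apply/and5P; split; lra.
  have [_ + _ _] := hK _ _ _ _ theta 0 f S th unit0.
  have /andP[th0 _] := th.
  by rewrite spow_pos ?subr_gt0// spow_nneg ?subr_ge0// -!EFinM lee_fin mulrA.
- move=> tau t s theta f s0 st ttau tauT th.
  have S : simplex T [:: tau; t; s; s].
    by rewrite /simplex /= lexx; apply/and5P; split; lra.
  have [_ _ + _] := hK _ _ _ _ theta 0 f S th unit0.
  have /andP[th0 _] := th.
  by rewrite spow_pos ?subr_gt0// spow_nneg ?subr_ge0// -!EFinM lee_fin mulrA.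
- move=> tau t s r theta f r0 rs st ttau rtau tauT th.
  have S : simplex T [:: tau; t; s; r].
    by rewrite /simplex /=; apply/and5P; split; lra.
  have unit1 : 0 <= (1 : R) <= 1 by rewrite lexx ler01.
  have [_ _ _ +] := hK _ _ _ _ theta 1 f S th unit1.
  have /andP[th0 _] := th.
  (* [spow] takes absolute values, so r - s can be replaced by the nonnegative s - r. *)
  rewrite (spow_distC r) spow_pos ?subr_gt0// !spow_nneg ?subr_ge0//; rewrite -!EFinM lee_fin mulrA.
  by rewrite (powRr1 (_ : 0 <= s - r)) ?subr_ge0.
Qed.

Lemma holder_bound (T gamma : R) (W : R -> H) : holder T gamma W ->
  exists2 C, 0 <= C & forall u v, 0 <= u -> u <= v -> v <= T ->
    `|W v - W u| <= C * (v - u) `^ gamma.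
Proof.
move=> [C hC]; exists `|C| => // u v u0 uv vT.
have := hC u v; rewrite u0 vT (le_trans uv vT) (le_trans u0 uv).
move=> /(_ isT isT) /le_trans; apply.
by rewrite [`|v - u|]ger0_norm ?subr_ge0// ler_wpM2r ?powR_ge0// ler_norm.
Qed.

End kernel_bounds.

(** * Comparison with the Volterra-Hoelder weights *)

Section weights.
Context {R : realType}.
Variables gamma eta : R.
Hypothesis gamma0 : 0 < gamma.
Hypothesis eta0 : 0 < eta.
Implicit Types (theta zeta d l e w : R).

(* The weight of [vh_norm12] without the factor |tau' - tau|^theta, for
   d = tau - t and l = t - s; at theta = zeta = 0 it is that of [vh_norm1]. *)
Definition vh_weight theta zeta d l : \bar R :=
  (spow d (- theta + zeta) *
   mine (spow d (- eta - zeta) * spow l gamma)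
        (spow (d + l) (gamma - eta - zeta)))%E.

Lemma vh_weight_ge0 theta zeta d l : (0 <= vh_weight theta zeta d l)%E.
Proof.
rewrite /vh_weight mule_ge0 ?spow_ge0// le_min spow_ge0 andbT.
by rewrite mule_ge0 ?spow_ge0.
Qed.

(** Each branch of the minimum is treated separately. In the first, e is lowered to d and w raised
    to l. In the second, e^(- eta - zeta) <= w^(- eta - zeta) leaves w^(gamma - eta - zeta), and w
    <= d + l. *)
Lemma le_vh_weight theta zeta d l e w :
  0 <= d -> 0 < l -> 0 < e -> d <= e -> 0 <= w -> w <= e -> w <= l ->
  0 <= zeta < gamma - eta -> zeta <= theta ->
  ((e `^ (- theta - eta) * w `^ gamma)%:E <= vh_weight theta zeta d l)%E.
Proof.
move=> d0 l0 e0 de w0 we wl /andP[z0 zk] zt.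
have dl0 : 0 < d + l by rewrite ltr_wpDl.
rewrite /vh_weight (spow_pos _ l0) (spow_pos _ dl0).
have second : e `^ (- theta - eta) * w `^ gamma <=
    e `^ (- theta + zeta) * (d + l) `^ (gamma - eta - zeta).
  rewrite (_ : - theta - eta = (- theta + zeta) + (- eta - zeta)); last by ring.
  rewrite (powRD_gt0 _ (- eta - zeta) e0) -mulrA ler_pM2l ?powR_gt0//.
  move: w0; rewrite le_eqVlt => /predU1P[<-|w0].
    by rewrite powR0 ?mulr0 ?powR_ge0// gt_eqF.
  apply: (@le_trans _ _ (w `^ (gamma - eta - zeta))).
    rewrite (_ : gamma - eta - zeta = (- eta - zeta) + gamma); last by ring.
    rewrite (powRD_gt0 _ gamma w0) ler_pM2r ?powR_gt0// -opprD le_powRN// addr_ge0//.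
    exact: ltW.
  by rewrite le_powR ?(ltW w0) ?subr_ge0 ?(ltW zk)// (le_trans wl)// lerDr.
move: d0; rewrite le_eqVlt => /predU1P[d0|d0]; last first.
  rewrite !spow_pos// -EFinM -EFin_min -EFinM lee_fin.
  rewrite minr_pMr ?powR_ge0// le_min; apply/andP; split.
    rewrite mulrA -powRD_gt0//.
    rewrite (_ : - theta + zeta + (- eta - zeta) = - (theta + eta)); last by ring.
    rewrite -opprD; apply: ler_pM; rewrite ?powR_ge0//; last first.
      exact: le_powR (ltW gamma0) w0 wl.
    by rewrite le_powRN// addr_ge0 ?(ltW eta0)// (le_trans z0).
  apply: le_trans second _; rewrite ler_wpM2r ?powR_ge0//.
  rewrite (_ : - theta + zeta = - (theta - zeta)); last by ring.
  by rewrite le_powRN// subr_ge0.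
(* At d = 0 the first branch is +oo, so the minimum is the second one. The prefactor is 0^0 = 1 if
   theta = zeta and +oo otherwise. *)
rewrite -d0 add0r in second *.
rewrite [spow 0 (- eta - zeta)]spow0_neg; last by rewrite -opprD oppr_lt0 ltr_pwDl.
rewrite gt0_mulye ?lte_fin ?powR_gt0// minye.
move: zt; rewrite le_eqVlt => /predU1P[zt|zt].
  rewrite zt addNr /spow ltxx andbF powRr0 mul1e lee_fin.
  by move: second; rewrite zt addNr powRr0 mul1r -zt.
rewrite spow0_neg; last by rewrite addrC subr_lt0.
by rewrite gt0_mulye ?lte_fin ?powR_gt0// leey.
Qed.

(** A zero weight forces x = 0 and the quotient is 0 / 0 = 0; an infinite weight makes the quotient
    0. *)
Lemma dive_le (x M : R) (y : \bar R) : 0 <= x -> 0 <= M -> (0 <= y)%E ->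
  (x%:E <= M%:E * y)%E -> (x%:E / y <= M%:E)%E.
Proof.
move=> x0 M0; case: y => [y| |]//.
- rewrite lee_fin le_eqVlt => /predU1P[<-|y0].
    rewrite mule0 lee_fin => x0'; have -> : x = 0 by apply/le_anti/andP.
    by rewrite mul0e lee_fin.
  rewrite -EFinM lee_fin inver gt_eqF// -EFinM lee_fin => h.
  by rewrite ler_pdivrMr.
- by rewrite invey mule0 lee_fin.
Qed.

End weights.

(** * Power estimates behind the controls *)

Section power_estimates.
Context {R : realType}.
Variables gamma eta : R.
Hypothesis gamma0 : 0 < gamma.
Hypothesis eta0 : 0 < eta.
Hypothesis gamma_eta : 0 < gamma - eta.
Hypothesis gamma1 : gamma < 1.
Implicit Types (a x y z q A B : R).

Lemma mul_powR_le x y z : 0 <= x -> 0 <= y -> x <= z -> y <= z ->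
  x * y `^ gamma <= z `^ (1 + gamma).
Proof.
move=> x0 y0 xz yz; have z0 := le_trans x0 xz.
rewrite -(mulr_powRB1 z0); last by rewrite ltr_wpDl.
rewrite addrAC subrr add0r; apply: ler_pM => //; first exact: powR_ge0.
exact: le_powR (ltW gamma0) y0 yz.
Qed.

Lemma le_powRN_double a x q : 0 <= q -> 0 < a -> 0 < x -> x <= a *+ 2 ->
  a `^ (- q) <= 2 `^ q * x `^ (- q).
Proof.
move=> q0 a0 x0 xa; have := le_powRN q0 x0 xa.
rewrite -[a *+ 2]mulr_natl powRM ?(ltW a0)// (powRN 2).
by rewrite -ler_pdivlMl ?invr_gt0 ?powR_gt0// invrK.
Qed.

Lemma defect_singular a x y : 0 <= x -> 0 < y -> y <= a ->
  let B := 2 `^ (1 + eta) * ((a + x) `^ (- (1 + eta)) * (x + y) `^ (1 + gamma)) in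
  (x <= a -> a `^ (- (1 + eta)) * (x * y `^ gamma) <= B) /\
  (a < x -> a `^ (- eta) * y `^ gamma <= B).
Proof.
move=> x0 y0 ya B; have a0 := lt_le_trans y0 ya.
have ax0 : 0 < a + x by rewrite ltr_pwDl.
have e10 : 0 <= 1 + eta by rewrite addr_ge0 ?(ltW eta0).
rewrite /B (mulrA (2 `^ _)); split=> [xa|ax].
  apply: ler_pM; rewrite ?powR_ge0 ?mulr_ge0 ?powR_ge0//.
    by apply: le_powRN_double; rewrite // mulr2n lerD2l.
  by apply: mul_powR_le; rewrite ?(ltW y0)// ?lerDl ?lerDr ?(ltW y0).
have xp : 0 < x := lt_trans a0 ax.
apply: (@le_trans _ _ (x `^ (- (1 + eta)) * x `^ (1 + gamma))); last first.
  apply: ler_pM; rewrite ?powR_ge0//.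
    by apply: le_powRN_double; rewrite // mulr2n lerD2r ltW.
  by rewrite le_powR// ?lerDl ?(ltW y0)// addr_ge0 ?(ltW gamma0).
rewrite -powRD_gt0// (_ : - (1 + eta) + (1 + gamma) = gamma - eta); last by ring.
apply: (@le_trans _ _ (a `^ (gamma - eta))); last by rewrite le_powR ?(ltW ax) ?ltW.
rewrite [gamma - eta]addrC powRD_gt0// ler_pM2l ?powR_gt0//.
exact: le_powR (ltW gamma0) (ltW y0) ya.
Qed.

(** The exponents solve (rho - 1) (1 + gamma) = - (1 + eta) and (- sigma - 1) (1 + gamma) = - (2 +
    eta): the slopes of the two powers, raised to 1 + gamma, reproduce the singularities of the
    first and second differences of the kernel. *)
Definition vrho : R := (gamma - eta) / (1 + gamma).
Definition vsigma : R := (1 + eta - gamma) / (1 + gamma).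

Lemma gamma10 : 0 < 1 + gamma.
Proof. by rewrite addr_gt0. Qed.

Lemma vrho01 : 0 < vrho <= 1.
Proof.
rewrite divr_gt0 ?gamma10//= ler_pdivrMr ?gamma10// mul1r.
by move: eta0; lra.
Qed.

Lemma vsigma_gt0 : 0 < vsigma.
Proof. by rewrite divr_gt0 ?gamma10//; move: eta0 gamma1; lra. Qed.

(** The tangent at A bounds A^rho - B^rho below by rho A^(rho - 1) (A - B); it remains to raise this
    to the power 1 + gamma. *)
Lemma vrho_increment A B : 0 < A -> 0 <= B -> B <= A ->
  A `^ (- (1 + eta)) * (A - B) `^ (1 + gamma) <=
  vrho `^ (- (1 + gamma)) * (A `^ vrho - B `^ vrho) `^ (1 + gamma).
Proof.
move=> A0 B0 BA; have /andP[r0 r1] := vrho01.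
have g0 := gamma10.
have h : vrho * A `^ (vrho - 1) * (A - B) <= A `^ vrho - B `^ vrho.
  have := powR_tangent_le A0 B0 vrho01.
  by rewrite -[B - A]opprB mulrN; set X := _ * (A - B); lra.
rewrite (powRN _ (1 + gamma)) ler_pdivlMl ?powR_gt0//.
have AB : 0 <= A - B by rewrite subr_ge0.
have l0 := mulr_ge0 (ltW r0) (powR_ge0 A (vrho - 1)).
apply: le_trans (le_powR (ltW g0) (mulr_ge0 l0 AB) h).
rewrite (powRM _ l0 AB) (powRM _ (ltW r0) (powR_ge0 _ _)) -powRrM.
rewrite (_ : (vrho - 1) * (1 + gamma) = - (1 + eta)) ?mulrA//.
by rewrite /vrho; field; rewrite gt_eqF.
Qed.

Lemma vsigma_increment A B : 0 < B -> B <= A ->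
  A `^ (- (2 + eta)) * (A - B) `^ (1 + gamma) <=
  vsigma `^ (- (1 + gamma)) * (B `^ (- vsigma) - A `^ (- vsigma)) `^ (1 + gamma).
Proof.
move=> B0 BA; have A0 := lt_le_trans B0 BA; have s0 := vsigma_gt0.
have g0 := gamma10.
have h : vsigma * A `^ (- vsigma - 1) * (A - B) <=
    B `^ (- vsigma) - A `^ (- vsigma).
  have := powR_tangent_ge A0 B0 (ltW s0).
  by rewrite -[B - A]opprB mulrN; set X := _ * (A - B); lra.
rewrite (powRN _ (1 + gamma)) ler_pdivlMl ?powR_gt0//.
have AB : 0 <= A - B by rewrite subr_ge0.
have l0 := mulr_ge0 (ltW s0) (powR_ge0 A (- vsigma - 1)).
apply: le_trans (le_powR (ltW g0) (mulr_ge0 l0 AB) h).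
rewrite (powRM _ l0 AB) (powRM _ (ltW s0) (powR_ge0 _ _)) -powRrM.
rewrite (_ : (- vsigma - 1) * (1 + gamma) = - (2 + eta)) ?mulrA//.
by rewrite /vsigma; field; rewrite gt_eqF.
Qed.

End power_estimates.

(** * Defects of the Volterra germs and their controls *)

Section volterra_germs.
Context {R : realType} {H : completeNormedModType R}.
Variables (T gamma eta C CW : R).
Hypothesis gamma01 : 0 < gamma < 1.
Hypothesis eta0 : 0 < eta.
Hypothesis gamma_eta : 0 < gamma - eta.
Hypothesis C0 : 0 <= C.
Hypothesis CW0 : 0 <= CW.
Variables (W : R -> H) (K : R -> R -> {linear H -> H}).
Hypothesis WP : forall u v, 0 <= u -> u <= v -> v <= T ->
  `|W v - W u| <= CW * (v - u) `^ gamma.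
Hypothesis KP : kernel_bound T eta C K.

Let gamma0 : 0 < gamma. Proof. by case/andP: gamma01. Qed.
Let gamma1 : gamma < 1. Proof. by case/andP: gamma01. Qed.
Let eta10 : 0 <= 1 + eta. Proof. by rewrite addr_ge0// ltW. Qed.

Local Notation germ := (volterra_germ K W).
Local Notation p := (1 + gamma).
Local Notation rho := (vrho gamma eta).
Local Notation sigma := (vsigma gamma eta).

Let CCW0 : 0 <= C * CW. Proof. exact: mulr_ge0. Qed.

Lemma germ_diag tau u : germ tau u u = 0.
Proof. by rewrite /volterra_germ subrr linear0. Qed.

(** By linearity the first two germs combine into K(tau, u) (W v - W m). An increment of K then
    meets one of W, which gives order 1 + gamma where K is Lipschitz. *)
Lemma germ_defect tau u m v :
  germ tau v u - germ tau m u - germ tau v m =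
  K tau u (W v - W m) - K tau m (W v - W m).
Proof.
by rewrite /volterra_germ -linearB opprB addrA subrK.
Qed.

Definition singular_constant : R :=
  C * CW * (2 `^ (1 + eta) * rho `^ (- p)).

Lemma singular_constant_ge0 : 0 <= singular_constant.
Proof. by apply: (mulr_ge0 CCW0); rewrite mulr_ge0 ?powR_ge0. Qed.

(* The exponent [rho] is chosen so that the control [(tau - u)^rho -
   (tau - v)^rho], raised to the power [1 + gamma], scales like
   [|v - u|^(gamma - eta)] at the singularity and like
   [(tau - u)^(- 1 - eta) |v - u|^(1 + gamma)] away from it. *)
Lemma germ_control_singular tau : 0 <= tau -> tau <= T ->
  germ_control (germ tau) (fun r => - (tau - r) `^ rho) p singular_constant
    0 tau.
Proof.
move=> tau0 tauT; have /andP[r0 r1] := vrho01 gamma0 eta0 gamma_eta.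
split; [move=> u v u0 uv vt|exact: germ_diag|move=> u m v u0 um].
  by rewrite lerN2 le_powR ?(ltW r0)// ?subr_ge0// lerD2l lerN2.
(* For m = v the point m may be tau, where the kernel is not controlled, but then the increment of W
   is zero. *)
rewrite le_eqVlt => /predU1P[<-|mv] vtau; rewrite germ_defect.
  rewrite !subrr !linear0 addr0 normr0.
  by rewrite mulr_ge0 ?powR_ge0 ?singular_constant_ge0.
have mtau : m < tau := lt_le_trans mv vtau.
have m0 := le_trans u0 um.
have uv := le_trans um (ltW mv).
have Wmv := WP m0 (ltW mv) (le_trans vtau tauT).
have [_ k2 _ _] := KP.
have mu0 : 0 <= m - u by rewrite subr_ge0.
have vm0 : 0 < v - m by rewrite subr_gt0.
have vmt : v - m <= tau - m by rewrite lerD2r.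
have [h1 h2] := defect_singular gamma0 eta0 gamma_eta mu0 vm0 vmt.
have bound X : 0 <= X -> X * (v - m) `^ gamma <= 2 `^ (1 + eta) *
     ((tau - m + (m - u)) `^ (- (1 + eta)) * (m - u + (v - m)) `^ p) ->
   `|K tau u (W v - W m) - K tau m (W v - W m)| <= C * X * `|W v - W m| ->
   `|K tau u (W v - W m) - K tau m (W v - W m)| <= singular_constant *
     (- (tau - v) `^ rho - - (tau - u) `^ rho) `^ p.
  move=> X0 hX /le_trans; apply.
  apply: le_trans (ler_wpM2l (mulr_ge0 C0 X0) Wmv) _.
  rewrite mulrACA /singular_constant -[leRHS]mulrA; apply: (ler_wpM2l CCW0).
  apply: le_trans hX _; rewrite -mulrA ler_wpM2l ?powR_ge0//.
  rewrite opprK [- _ + _]addrC subrKA.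
  rewrite (_ : m - u + (v - m) = (tau - u) - (tau - v)); last by ring.
  apply: vrho_increment => //; rewrite ?subr_ge0//.
    by rewrite subr_gt0 (le_lt_trans um).
  by rewrite lerD2l lerN2.
(* The kernel estimate is used with theta = 1 for steps up to the distance to the singularity, and
   with theta = 0 for longer ones. *)
have [mut|mut] := leP (m - u) (tau - m).
  apply: (bound ((tau - m) `^ (- (1 + eta)) * (m - u))).
  - by rewrite mulr_ge0 ?powR_ge0.
  - by rewrite -mulrA; exact: h1.
  - rewrite distrC; have := k2 tau m u 1 (W v - W m) u0 um mtau tauT.
    by rewrite powRr1// lexx ler01 -opprD [eta + 1]addrC; apply.
apply: (bound ((tau - m) `^ (- eta))); [exact: powR_ge0|exact: h2|].
rewrite distrC; have := k2 tau m u 0 (W v - W m) u0 um mtau tauT.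
by rewrite powRr0 mulr1 subr0 lexx ler01; apply.
Qed.

(** Up to t < tau the distance to the singularity is at least tau - t, so K is Lipschitz with one
    constant and time itself is the control. *)
Lemma germ_control_regular tau t : 0 <= t -> t < tau -> tau <= T ->
  germ_control (germ tau) id p (C * CW * (tau - t) `^ (- (1 + eta))) 0 t.
Proof.
move=> t0 ttau tauT.
split; [by []|exact: germ_diag|move=> u m v u0 um mv vt].
have mt : m <= t := le_trans mv vt.
have mtau : m < tau := le_lt_trans mt ttau.
have uv := le_trans um mv.
have Wmv := WP (le_trans u0 um) mv (le_trans vt (le_trans (ltW ttau) tauT)).
have [_ k2 _ _] := KP.
rewrite germ_defect distrC.
have := k2 tau m u 1 (W v - W m) u0 um mtau tauT.
rewrite powRr1 ?subr_ge0// lexx ler01 -opprD [eta + 1]addrC => /(_ isT).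
move=> /le_trans; apply; rewrite -!mulrA (ler_wpM2l C0)//.
rewrite [leRHS]mulrCA; apply: ler_pM; rewrite ?powR_ge0//.
- by rewrite mulr_ge0 ?subr_ge0.
- by rewrite le_powRN ?subr_gt0// lerD2l lerN2.
apply: le_trans (ler_wpM2l _ Wmv) _; first by rewrite subr_ge0.
rewrite mulrCA (ler_wpM2l CW0)// mul_powR_le ?subr_ge0//.
  by rewrite lerD2r.
by rewrite lerD2l lerN2.
Qed.

(** Sewing the difference, rather than each germ, keeps the cancellation in tau' - tau. *)
Definition germB tau' tau v u : H := germ tau' v u - germ tau v u.

Lemma germB_diag tau' tau u : germB tau' tau u u = 0.
Proof. by rewrite /germB !germ_diag subrr. Qed.

(** The defect is, up to sign, a second difference of K applied to W v - W m. Its singular base tau'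
    - u stays positive because tau < tau'. *)
Lemma germB_defect tau' tau theta u m v : 0 <= u -> u <= m -> m <= v ->
  v <= tau -> tau < tau' -> tau' <= T -> 0 <= theta <= 1 ->
  `|germB tau' tau v u - germB tau' tau m u - germB tau' tau v m| <=
  C * CW * (tau' - tau) `^ theta *
  ((tau' - u) `^ (- (1 + theta + eta)) * (v - u) `^ p).
Proof.
move=> u0 um mv vtau tautau' tau'T th.
have mtau := le_trans mv vtau; have uv := le_trans um mv.
have Wmv := WP (le_trans u0 um) mv
  (le_trans vtau (le_trans (ltW tautau') tau'T)).
have [_ _ _ k4] := KP.
have -> : germB tau' tau v u - germB tau' tau m u - germB tau' tau v m =
    - (K tau' m (W v - W m) - K tau' u (W v - W m) - K tau m (W v - W m)
       + K tau u (W v - W m)).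
  have E r := germ_defect r u m v.
  rewrite /germB (_ : forall a b c d e f : H, a - b - (c - d) - (e - f) =
    a - c - e - (b - d - f)); last first.
    by move=> a b c d e f; rewrite !opprD !opprK !addrA [LHS](ACl (1*3*5*2*4*6)).
  by rewrite !E !opprD !opprK !addrA [LHS](ACl (2*1*4*3)).
rewrite normrN.
have := k4 tau' tau m u theta (W v - W m) u0 um mtau (ltW tautau').
move=> /(_ (le_lt_trans (le_trans um mtau) tautau') tau'T th) /le_trans; apply.
rewrite (_ : -1 - theta - eta = - (1 + theta + eta)); last by ring.
set X := _ `^ (- _); set Y := _ `^ theta.
have X0 : 0 <= X := powR_ge0 _ _; have Y0 : 0 <= Y := powR_ge0 _ _.
have mu0 : 0 <= m - u by rewrite subr_ge0.
apply: le_trans (ler_wpM2l _ Wmv) _; first by rewrite !mulr_ge0.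
rewrite [leLHS](_ : _ = C * CW * Y * (X * ((m - u) * (v - m) `^ gamma))); last by ring.
rewrite (ler_wpM2l (mulr_ge0 CCW0 Y0))// (ler_wpM2l X0)// mul_powR_le ?subr_ge0//.
  by rewrite lerD2r.
by rewrite lerD2l lerN2.
Qed.

Lemma germB_control_regular tau' tau t theta : 0 <= t -> t <= tau ->
  tau < tau' -> tau' <= T -> 0 <= theta <= 1 ->
  germ_control (germB tau' tau) id p
    (C * CW * (tau' - tau) `^ theta * (tau' - t) `^ (- (1 + theta + eta))) 0 t.
Proof.
move=> t0 ttau tautau' tau'T th; have /andP[th0 _] := th.
split; [by []|exact: germB_diag|move=> u m v u0 um mv vt].
apply: le_trans (germB_defect u0 um mv (le_trans vt ttau) tautau' tau'T th) _.
rewrite -[leRHS]mulrA; apply: (ler_wpM2l (mulr_ge0 CCW0 (powR_ge0 _ _))).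
rewrite ler_wpM2r ?powR_ge0// le_powRN//.
- by rewrite !addr_ge0// ltW.
- by rewrite subr_gt0 (le_lt_trans ttau).
- by rewrite lerD2l lerN2 (le_trans um)// (le_trans mv).
Qed.

(* Here [- sigma * p = gamma - eta - 1], the homogeneity left after one power
   of [tau' - tau] is taken out of the second difference of the kernel. *)
Lemma germB_control_singular tau' tau t : 0 <= t -> t <= tau ->
  tau < tau' -> tau' <= T ->
  germ_control (germB tau' tau) (fun r => (tau' - r) `^ (- sigma)) p
    (C * CW * (tau' - tau) * sigma `^ (- p)) 0 t.
Proof.
move=> t0 ttau tautau' tau'T; have s0 := vsigma_gt0 gamma0 eta0 gamma1.
have ttau' := le_lt_trans ttau tautau'.
split; [move=> u v u0 uv vt|exact: germB_diag|move=> u m v u0 um mv vt].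
  by rewrite le_powRN ?(ltW s0) ?subr_gt0 ?(le_lt_trans vt)// lerD2l lerN2.
have th : 0 <= (1 : R) <= 1 by rewrite ler01 lexx.
apply: le_trans (germB_defect u0 um mv (le_trans vt ttau) tautau' tau'T th) _.
have tt0 : 0 <= tau' - tau by rewrite subr_ge0 ltW.
rewrite powRr1// -[leRHS]mulrA; apply: (ler_wpM2l (mulr_ge0 CCW0 tt0)).
rewrite (_ : 1 + 1 + eta = 2 + eta)// (_ : v - u = (tau' - u) - (tau' - v)).
  apply: vsigma_increment => //; first by rewrite subr_gt0 (le_lt_trans vt).
  by rewrite lerD2l lerN2 (le_trans um).
by ring.
Qed.

(** * Existence and increments of the Volterra integral *)

Lemma volterra_cvg tau t : 0 <= t -> t <= tau -> tau <= T ->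
  cvg (riemann_sum (germ tau) 0 @ mesh_to0 0 t).
Proof.
move=> t0 ttau tauT; have tau0 := le_trans t0 ttau.
have rho01 := vrho01 gamma0 eta0 gamma_eta; have /andP[r0 r1] := rho01.
have p1 : 1 < p by rewrite ltrDl.
apply: (sewing_cvg p1 singular_constant_ge0 t0
  (germ_control_sub ttau (germ_control_singular tau0 tauT))) => e e0.
(* By subadditivity of the power rho, the control is rho-Hoelder with constant 1. *)
exists (e `^ rho^-1); first exact: powR_gt0.
move=> u v u0 uv vt uve; rewrite opprK addrC.
have vu0 : 0 <= v - u by rewrite subr_ge0 ltW.
have tauv0 : 0 <= tau - v by rewrite subr_ge0 (le_trans vt).
have := powRD_le tauv0 vu0 rho01; rewrite subrKA => h.
have : (v - u) `^ rho <= (e `^ rho^-1) `^ rho by rewrite le_powR ?(ltW r0)// ltW.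
rewrite -powRrM mulVf ?gt_eqF// powRr1 ?(ltW e0)// => h'.
by rewrite lerBlDl (le_trans h)// lerD2l.
Qed.

Local Notation X := (volterra_integral K W).

Lemma powR_shift_le (q e l : R) : 0 < e -> 0 <= l -> l <= e ->
  e `^ (- (1 + q)) * l `^ p <= e `^ (- q) * l `^ gamma.
Proof.
move=> e0 l0 le.
rewrite -(mulr_powRB1 l0); last by rewrite addr_gt0.
rewrite addrAC subrr add0r opprD powRD_gt0// powR_inv1 ?(ltW e0)// mulrACA.
by rewrite ler_piMl ?mulr_ge0 ?powR_ge0// mulrC ler_pdivrMr// mul1r.
Qed.

(** The first term bounds the germ, the second the sewing remainder; its two summands serve the
    singular and the regular control. *)
Definition volterra_constant : R :=
  C * CW + sewing_const p * (singular_constant * 2 + C * CW).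

Lemma sewing_const_p_ge0 : 0 <= sewing_const p.
Proof. by rewrite ltW// sewing_const_gt0// ltrDl. Qed.

Lemma volterra_constant_ge0 : 0 <= volterra_constant.
Proof.
apply: (addr_ge0 CCW0); apply: (mulr_ge0 sewing_const_p_ge0).
by apply: addr_ge0 => //; apply: (mulr_ge0 singular_constant_ge0).
Qed.

Lemma volterra_increment tau t s : 0 <= s -> s < t -> t <= tau -> tau <= T ->
  exists e w, [/\ 0 < e, tau - t <= e, 0 <= w, w <= e /\ w <= t - s
    & `|X tau t - X tau s| <= volterra_constant *
      ((tau - s) `^ (- eta) * (t - s) `^ gamma + e `^ (- eta) * w `^ gamma)].
Proof.
move=> s0 st ttau tauT.
have t0 := le_trans s0 (ltW st); have tau0 := le_trans t0 ttau.
have stau := lt_le_trans st ttau.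
have p1 : 1 < p by rewrite ltrDl.
have cs := volterra_cvg s0 (ltW stau) tauT.
have ct := volterra_cvg t0 ttau tauT.
have main : `|germ tau t s| <=
    C * CW * ((tau - s) `^ (- eta) * (t - s) `^ gamma).
  have [k1 _ _ _] := KP; apply: le_trans (k1 _ _ _ s0 stau tauT) _.
  rewrite -!mulrA (ler_wpM2l C0)// mulrCA ler_wpM2l ?powR_ge0//.
  by apply: WP => //; [exact: ltW|exact: le_trans tauT].
have split_main B e w : 0 <= B -> B <= singular_constant * 2 + C * CW ->
    `|X tau t - X tau s - germ tau t s| <=
      sewing_const p * B * (e `^ (- eta) * w `^ gamma) ->
    `|X tau t - X tau s| <= volterra_constant *
      ((tau - s) `^ (- eta) * (t - s) `^ gamma + e `^ (- eta) * w `^ gamma).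
  move=> B0 hB h; rewrite -[_ - X tau s](subrK (germ tau t s)).
  apply: le_trans (ler_normD _ _) _; rewrite mulrDr addrC lerD//.
    apply: le_trans main _; rewrite ler_wpM2r ?mulr_ge0 ?powR_ge0//.
    rewrite lerDl; apply: (mulr_ge0 sewing_const_p_ge0).
    exact: le_trans B0 hB.
  apply: le_trans h _; rewrite ler_wpM2r ?mulr_ge0 ?powR_ge0//.
  rewrite ler_wpDl//; exact: (ler_wpM2l sewing_const_p_ge0).
have l0 : 0 < t - s by rewrite subr_gt0.
(* An interval no longer than its distance to tau is sewn with time as control, at scale e = tau -
   t. A longer one takes the singular control, at scale e = w = t - s. *)
have [ld|dl] := leP (t - s) (tau - t).
  have d0 := lt_le_trans l0 ld.
  have ttau' : t < tau by rewrite -subr_gt0.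
  exists (tau - t), (t - s); split => //; first exact: ltW.
  apply: (split_main (C * CW)) => //.
    by rewrite lerDr (mulr_ge0 singular_constant_ge0).
  have B0 := mulr_ge0 CCW0 (powR_ge0 (tau - t) (- (1 + eta))).
  have := sewing_increment p1 B0 s0 (ltW st)
    (germ_control_regular t0 ttau' tauT) cs ct.
  move=> /le_trans; apply; rewrite [leLHS](_ : _ = sewing_const p * (C * CW) *
    ((tau - t) `^ (- (1 + eta)) * (t - s) `^ p)); last by rewrite /=; ring.
  rewrite (ler_wpM2l (mulr_ge0 sewing_const_p_ge0 CCW0))//.
  by apply: powR_shift_le => //; exact: ltW.
exists (t - s), (t - s); split; rewrite ?(ltW dl) ?(ltW l0)//.
apply: (split_main (singular_constant * 2)).
- by apply: (mulr_ge0 singular_constant_ge0).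
- by rewrite lerDl.
have := sewing_increment p1 singular_constant_ge0 s0 (ltW st)
  (germ_control_sub ttau (germ_control_singular tau0 tauT)) cs ct.
move=> /le_trans; apply; rewrite -[leLHS]mulrA -[leRHS]mulrA.
apply: (ler_wpM2l sewing_const_p_ge0); rewrite -[leRHS]mulrA.
rewrite (ler_wpM2l singular_constant_ge0)// opprK addrC.
have /andP[r0 r1] := vrho01 gamma0 eta0 gamma_eta.
have dtau0 : 0 <= tau - t by rewrite subr_ge0.
have stau0 : 0 < tau - s by rewrite subr_gt0.
have tsle : tau - t <= tau - s by rewrite lerD2l lerN2 ltW.
apply: (@le_trans _ _ (((tau - s) `^ rho) `^ p)).
  apply: le_powR; first by rewrite addr_ge0// ltW.
    by rewrite subr_ge0; apply: le_powR => //; exact: ltW.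
  by rewrite gerBl powR_ge0.
rewrite -powRrM /vrho mulfVK ?gt_eqF ?addr_gt0// -powRD_gt0// [- eta + _]addrC.
(* In this regime tau - s < 2 (t - s), and 2^(gamma - eta) <= 2 accounts for the factor 2 in the
   constant. *)
apply: (@le_trans _ _ ((2 * (t - s)) `^ (gamma - eta))).
  by apply: le_powR; [exact: ltW|exact: ltW|move: dl; lra].
rewrite powRM ?(ltW l0)// ler_wpM2r ?powR_ge0//.
by rewrite ler1_powR ?ler1n//; move: eta0 gamma1; lra.
Qed.

Definition volterraB_constant : R :=
  C * CW + sewing_const p * (C * CW * (1 + sigma `^ (- p))).

Lemma volterraB_constant_ge0 : 0 <= volterraB_constant.
Proof.
apply: (addr_ge0 CCW0); apply: (mulr_ge0 sewing_const_p_ge0).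
by apply: (mulr_ge0 CCW0); rewrite addr_ge0 ?powR_ge0.
Qed.

Lemma volterraB_increment tau' tau t s theta :
  0 <= s -> s < t -> t <= tau -> tau < tau' -> tau' <= T -> 0 <= theta <= 1 ->
  exists e w, [/\ 0 < e, tau - t <= e, 0 <= w, w <= e /\ w <= t - s
    & `|X tau' t - X tau t - X tau' s + X tau s| <=
      volterraB_constant * ((tau' - tau) `^ theta *
        ((tau - s) `^ (- theta - eta) * (t - s) `^ gamma
         + e `^ (- theta - eta) * w `^ gamma))].
Proof.
move=> s0 st ttau tautau' tau'T th; have /andP[th0 th1] := th.
have t0 := le_trans s0 (ltW st).
have stau := lt_le_trans st ttau.
have tauT := le_trans (ltW tautau') tau'T.
have p1 : 1 < p by rewrite ltrDl.
have h0 : 0 < tau' - tau by rewrite subr_gt0.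
have germB_cvg r : 0 <= r -> r <= tau ->
    riemann_sum (germB tau' tau) 0 @ mesh_to0 0 r --> X tau' r - X tau r.
  move=> r0 rtau; rewrite [X in X @ _](_ : _ =
    riemann_sum (germ tau') 0 \- riemann_sum (germ tau) 0).
    have rtau' := le_trans rtau (ltW tautau').
    apply: cvgB; [exact: (volterra_cvg r0 rtau' tau'T)
                 |exact: (volterra_cvg r0 rtau tauT)].
  by apply/funext => q; rewrite /germB riemann_sumB.
have germB_lim r : 0 <= r -> r <= tau ->
    lim (riemann_sum (germB tau' tau) 0 @ mesh_to0 0 r) = X tau' r - X tau r.
  move=> r0 rtau; have F := mesh_to0_proper r0.
  by apply/cvg_lim => //; exact: germB_cvg.
have cs : cvg (riemann_sum (germB tau' tau) 0 @ mesh_to0 0 s).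
  by apply/cvg_ex; exists (X tau' s - X tau s); exact: germB_cvg s0 (ltW stau).
have ct : cvg (riemann_sum (germB tau' tau) 0 @ mesh_to0 0 t).
  by apply/cvg_ex; exists (X tau' t - X tau t); exact: germB_cvg.
have incr g B : 0 <= B -> germ_control (germB tau' tau) g p B 0 t ->
    `|X tau' t - X tau t - X tau' s + X tau s - germB tau' tau t s| <=
      sewing_const p * B * (g t - g s) `^ p.
  move=> B0 hg; have := sewing_increment p1 B0 s0 (ltW st) hg cs ct.
  by rewrite !germB_lim ?(ltW stau)// opprB addrA [_ + X tau s]addrAC.
have main : `|germB tau' tau t s| <= C * CW *
    ((tau' - tau) `^ theta * ((tau - s) `^ (- theta - eta) * (t - s) `^ gamma)).
  have [_ _ k3 _] := KP.
  apply: le_trans (k3 tau' tau s theta _ s0 stau (ltW tautau') tau'T th) _.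
  rewrite [- eta - theta]addrC.
  apply: le_trans (ler_wpM2l _ (WP s0 (ltW st) (le_trans ttau tauT))) _.
    by apply: (mulr_ge0 C0); rewrite mulr_ge0 ?powR_ge0.
  by rewrite le_eqVlt; apply/orP; left; apply/eqP; ring.
have split_main B e w : 0 <= B -> B <= C * CW * (1 + sigma `^ (- p)) ->
    `|X tau' t - X tau t - X tau' s + X tau s - germB tau' tau t s| <=
      sewing_const p * B *
        ((tau' - tau) `^ theta * (e `^ (- theta - eta) * w `^ gamma)) ->
    `|X tau' t - X tau t - X tau' s + X tau s| <=
      volterraB_constant * ((tau' - tau) `^ theta *
        ((tau - s) `^ (- theta - eta) * (t - s) `^ gamma
         + e `^ (- theta - eta) * w `^ gamma)).
  move=> B0 hB h; rewrite -[_ + X tau s](subrK (germB tau' tau t s)).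
  apply: le_trans (ler_normD _ _) _; rewrite 2!mulrDr addrC lerD//.
    apply: le_trans main _; rewrite ler_wpM2r ?mulr_ge0 ?powR_ge0//.
    rewrite lerDl; apply: (mulr_ge0 sewing_const_p_ge0).
    exact: le_trans B0 hB.
  apply: le_trans h _; rewrite ler_wpM2r ?mulr_ge0 ?powR_ge0//.
  rewrite ler_wpDl//; exact: (ler_wpM2l sewing_const_p_ge0).
have l0 : 0 < t - s by rewrite subr_gt0.
have e0 : 0 < tau' - t by rewrite subr_gt0 (le_lt_trans ttau).
have de : tau - t <= tau' - t by rewrite lerD2r ltW.
have he : tau' - tau <= tau' - t by rewrite lerD2l lerN2.
have S0 : 0 <= sigma `^ (- p) := powR_ge0 _ _.
(* The scale is e = tau' - t in both regimes. On long intervals w = e as well, since dropping the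
   power of tau' - s leaves a bound independent of s. *)
have [le|el] := leP (t - s) (tau' - t).
  exists (tau' - t), (t - s); split => //; first exact: ltW.
  apply: (split_main (C * CW)) => //; first by rewrite ler_peMr// lerDl.
  have Y0 := powR_ge0 (tau' - tau) theta.
  have B0 := mulr_ge0 (mulr_ge0 CCW0 Y0)
    (powR_ge0 (tau' - t) (- (1 + theta + eta))).
  apply: le_trans (incr _ _ B0 (germB_control_regular t0 ttau tautau' tau'T th)) _.
  rewrite [leLHS](_ : _ = sewing_const p * (C * CW) * (tau' - tau) `^ theta *
    ((tau' - t) `^ (- (1 + (theta + eta))) * (t - s) `^ p)); last first.
    by rewrite addrA /=; ring.
  rewrite [leRHS]mulrA.
  rewrite (ler_wpM2l (mulr_ge0 (mulr_ge0 sewing_const_p_ge0 CCW0) Y0))// -opprD.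
  by apply: powR_shift_le => //; exact: ltW.
exists (tau' - t), (tau' - t); split; rewrite ?(ltW e0) ?(ltW el)//.
apply: (split_main (C * CW * sigma `^ (- p))).
- exact: mulr_ge0.
- by rewrite (ler_wpM2l CCW0)// lerDr.
have B0 := mulr_ge0 (mulr_ge0 CCW0 (ltW h0)) S0.
apply: le_trans (incr _ _ B0 (germB_control_singular t0 ttau tautau' tau'T)) _.
have sg0 := vsigma_gt0 gamma0 eta0 gamma1.
have esle : (tau' - t) <= tau' - s by rewrite lerD2l lerN2 ltW.
have SC0 := mulr_ge0 sewing_const_p_ge0 (mulr_ge0 CCW0 S0).
rewrite [leLHS](_ : _ = sewing_const p * (C * CW * sigma `^ (- p)) *
  ((tau' - tau) * ((tau' - t) `^ (- sigma) - (tau' - s) `^ (- sigma)) `^ p));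
  last by ring.
apply: (ler_wpM2l SC0).
apply: (@le_trans _ _ ((tau' - tau) * ((tau' - t) `^ (- sigma)) `^ p)).
  rewrite ler_pM2l//; apply: le_powR; first by rewrite addr_ge0// ltW.
    by rewrite subr_ge0 le_powRN// ltW.
  by rewrite gerBl powR_ge0.
rewrite -powRrM (_ : - sigma * p = - (1 + eta - gamma)); last first.
  by rewrite /vsigma mulNr mulfVK// gt_eqF// addr_gt0.
(* Only theta of the full power of tau' - tau is kept; the rest is at most (tau' - t)^(1 - theta),
   which makes the bound uniform in theta. *)
have hE : tau' - tau = (tau' - tau) `^ theta * (tau' - tau) `^ (1 - theta).
  by rewrite -powRD_gt0// addrCA subrr addr0 powRr1// ltW.
rewrite [X in X * _ <= _]hE -[leLHS]mulrA ler_wpM2l ?powR_ge0//.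
apply: (@le_trans _ _
    ((tau' - t) `^ (1 - theta) * (tau' - t) `^ (- (1 + eta - gamma)))).
  rewrite ler_wpM2r ?powR_ge0// le_powR ?(ltW h0) ?subr_ge0//.
rewrite -!powRD_gt0// le_eqVlt; apply/orP; left; apply/eqP; congr (_ `^ _).
by ring.
Qed.

End volterra_germs.

(** * Convergence, and finiteness of the Volterra-Hoelder norm *)

Theorem proposition14 (R : realType) (H : completeNormedModType R)
    (hilbertH : hilbert H) (separableH : separable_space H)
    (T : R) (T_gt0 : 0 < T)
    (gamma eta : R) (gamma01 : 0 < gamma < 1) (eta01 : 0 < eta < 1)
    (gamma_eta : 0 < gamma - eta)
    (W : R -> H) (W_holder : holder T gamma W)
    (K : R -> R -> {linear H -> H}) (K_kernel : volterra_kernel T eta K) :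
  (forall tau t : R, simplex T [:: tau; t] ->
     cvg (riemann_sum (volterra_germ K W tau) 0 @ mesh_to0 0 t)) /\
  volterra_holder T gamma eta (volterra_integral K W).
Proof.
have [C C0 KP] := volterra_kernel_bound K_kernel.
have [CW CW0 WP] := holder_bound W_holder.
have /andP[gamma0 gamma1] := gamma01; have /andP[eta0 eta1] := eta01.
split.
  move=> tau t /andP[/= /and3P[/andP[_ tauT] /andP[t0 _] _]] /andP[ttau _].
  exact: (volterra_cvg gamma01 eta0 gamma_eta C0 CW0 WP KP).
set M1 := volterra_constant gamma eta C CW.
set M2 := volterraB_constant gamma eta C CW.
have M10 : 0 <= M1 := volterra_constant_ge0 eta gamma01 C0 CW0.
have M20 : 0 <= M2 := volterraB_constant_ge0 eta gamma01 C0 CW0.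
(* [A1] and [A2] stand for the germ and the remainder; each is below the weight, whence the factor
   2. *)
have bound_dive (M c A1 A2 x : R) (wt : \bar R) :
    0 <= x -> 0 <= M -> 0 <= c -> (0 <= wt)%E ->
    x <= M * (c * (A1 + A2)) -> (A1%:E <= wt)%E -> (A2%:E <= wt)%E ->
    (x%:E / (c%:E * wt) <= (M * 2)%:E)%E.
  move=> x0 M0 c0 wt0 hx h1 h2; apply: dive_le => //.
  - by rewrite mulr_ge0.
  - by rewrite mule_ge0.
  apply: (@le_trans _ _ (M%:E * (c%:E * (A1%:E + A2%:E)))%E).
    by rewrite -EFinD -!EFinM lee_fin.
  rewrite EFinM -muleA; apply: lee_wpmul2l; rewrite ?lee_fin//.
  rewrite muleCA; apply: lee_wpmul2l; rewrite ?lee_fin//.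
  by rewrite mule_natl mule2n leeD.
rewrite /volterra_holder /vh_norm.
apply: (@le_lt_trans _ _ ((M1 * 2)%:E + (M2 * 2)%:E)%E); last first.
  by rewrite -EFinD ltry.
apply: leeD; apply: ge_ereal_sup => q /=.
  move=> [tau [t [s [/andP[/= /and4P[/andP[_ tauT] _ /andP[s0 _] _]]]]]].
  move=> /and3P[ttau st _] ->.
  set mn := mine _ _.
  (* As 0^0 = 1, the prefactor at theta = zeta = 0 is 1 even for tau = t, so both suprema are
     handled by the same weight. *)
  have -> : mn = (1%:E * vh_weight gamma eta 0 0 (tau - t) (t - s))%E.
    rewrite /vh_weight !(oppr0, addr0) subrKA mul1e.
    by rewrite [spow (tau - t) 0]/spow ltxx andbF powRr0 mul1e.
  have wt0 := vh_weight_ge0 gamma eta 0 0 (tau - t) (t - s).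
  have /predU1P[<-|{}st] : (s == t) || (s < t) by rewrite -le_eqVlt.
    by rewrite subrr normr0 mul0e lee_fin mulr_ge0.
  have [e [w [e0 de w0 [we wl] h]]] :=
    volterra_increment gamma01 eta0 gamma_eta C0 CW0 WP KP s0 st ttau tauT.
  have l0 : 0 < t - s by rewrite subr_gt0.
  have d0 : 0 <= tau - t by rewrite subr_ge0.
  have z0 : 0 <= (0 : R) < gamma - eta by rewrite lexx.
  have ts0 : 0 < tau - s by rewrite subr_gt0 (lt_le_trans st).
  have dts : tau - t <= tau - s by rewrite lerD2l lerN2 ltW.
  have lts : t - s <= tau - s by rewrite lerD2r.
  (* The germ has scales tau - s and t - s; the remainder has those supplied with its bound. *)
  have h1 := le_vh_weight gamma0 eta0 d0 l0 ts0 dts (ltW l0) lts (lexx _) z0 (lexx _).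
  have h2 := le_vh_weight gamma0 eta0 d0 l0 e0 de w0 we wl z0 (lexx _).
  by apply: (bound_dive _ _ _ _ _ _ _ _ _ _ _ h1 h2) => //;
    rewrite oppr0 add0r mul1r.
move=> [tau' [tau [t [s [theta [zeta [S th z0 zt ->]]]]]]].
move: S => /andP[/= /and5P[/andP[_ tau'T] _ _ /andP[s0 _] _]].
move=> /and4P[tautau' ttau st _].
have /andP[th0 th1] := th.
set wt := (_ * mine _ _)%E.
have {wt} -> : wt = (((tau' - tau) `^ theta)%:E *
    vh_weight gamma eta theta zeta (tau - t) (t - s))%E.
  by rewrite /wt /vh_weight subrKA -muleA spow_nneg ?subr_ge0.
have wt0 := vh_weight_ge0 gamma eta theta zeta (tau - t) (t - s).
(* For tau = tau' or s = t the numerator vanishes, hence the quotient too, whatever the weight. *)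
have /predU1P[<-|{}tautau'] : (tau == tau') || (tau < tau')
  by rewrite -le_eqVlt.
  by rewrite subrr sub0r addNr normr0 mul0e lee_fin mulr_ge0.
have /predU1P[<-|{}st] : (s == t) || (s < t) by rewrite -le_eqVlt.
  by rewrite addrAC subrK subrr normr0 mul0e lee_fin mulr_ge0.
have [e [w [e0 de w0 [we wl] h]]] := volterraB_increment gamma01 eta0 gamma_eta
  C0 CW0 WP KP s0 st ttau tautau' tau'T th.
have l0 : 0 < t - s by rewrite subr_gt0.
have d0 : 0 <= tau - t by rewrite subr_ge0.
have ts0 : 0 < tau - s by rewrite subr_gt0 (lt_le_trans st).
have dts : tau - t <= tau - s by rewrite lerD2l lerN2 ltW.
have lts : t - s <= tau - s by rewrite lerD2r.
have h1 := le_vh_weight gamma0 eta0 d0 l0 ts0 dts (ltW l0) lts (lexx _) z0 zt.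
have h2 := le_vh_weight gamma0 eta0 d0 l0 e0 de w0 we wl z0 zt.
by apply: (bound_dive _ _ _ _ _ _ _ _ _ _ _ h1 h2) => //; exact: powR_ge0.
Qed.
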